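(* In each of the elliptic ($\sigma=-1$), parabolic ($\sigma=0$) and hyperbolic ($\sigma=1$) cases, a Möbius invariant measure on $\mathbb{R}^a=\{ue_1+ve_2 : (u,v)\in\mathbb{R}^2\}$ is given by $\dfrac{du\,dv}{v^2}$. That is, for every $\sigma\in\{-1,0,1\}$, every $g\in SL_2(\mathbb{R})$ acting by the Möbius transformation $w\mapsto g\cdot w$ of type $\sigma$, and every Borel set $E\subset\{ue_1+ve_2 : v\neq0\}$ at all points of which $g\cdot w$ is defined, one has $\mu(g\cdot E)=\mu(E)$, where $d\mu=\dfrac{du\,dv}{v^2}$.
   Context: For $\sigma\in\{-1,0,1\}$ let $\mathcal{C}\ell(a)$ be the associative unital real algebra with linear basis $1,e_1,e_2,e_1e_2$ and multiplication determined by $e_1^2=-1$, $e_2^2=\sigma$, $e_1e_2=-e_2e_1$. The cases $\sigma=-1,0,1$ are called elliptic, parabolic and hyperbolic. The plane $\mathbb{R}^2$ is identified with the set of vectors $\mathbb{R}^a=\{ue_1+ve_2 : (u,v)\in\mathbb{R}^2\}\subset\mathcal{C}\ell(a)$. The group $SL_2(\mathbb{R})$ of real matrices $\begin{pmatrix} a & b \\ c & d \end{pmatrix}$ with $ad-bc=1$ is realised as the matrices $\begin{pmatrix} a & -b e_1 \\ c e_1 & d \end{pmatrix}$ over $\mathcal{C}\ell(a)$. The Möbius transformation of $\mathbb{R}^a$ defined by such an element $g$ is $$g\cdot(ue_1+ve_2)=\bigl(a(ue_1+ve_2)-be_1\bigr)\bigl(c e_1(ue_1+ve_2)+d\bigr)^{-1},$$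 which is defined at the points where $c e_1(ue_1+ve_2)+d$ is invertible in $\mathcal{C}\ell(a)$. *)

(* Defs.v *)
From HB Require Import structures.
From mathcomp Require Import all_boot all_order all_algebra all_field.
From mathcomp Require Import ring.
From mathcomp Require Import all_classical all_reals all_analysis.
From mathcomp Require Import measurable_realfun.

Set Implicit Arguments.
Unset Strict Implicit.
Unset Printing Implicit Defensive.

Import Order.TTheory GRing.Theory Num.Theory.
Local Open Scope classical_set_scope.
Local Open Scope ring_scope.

(* The row [a b c d] of [cl s] stands for a + b e1 + c e2 + d e1 e2, where
   e1^2 = -1, e2^2 = s and e1 e2 = - e2 e1. *)
Definition cl (K : fieldType) (s : K) : Type := 'rV[K]_4.

Section Clifford.
Context (K : fieldType) (s : K).
Implicit Types (a b c d t : K) (x y z : cl s).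

HB.instance Definition _ := Vector.copy (cl s) 'rV[K]_4.

Definition mkcl a b c d : cl s := \row_(i < 4) [:: a; b; c; d]`_i.

Definition co x (i : nat) : K := (x : 'rV[K]_4) ord0 (inord i).

Definition cl_one : cl s := mkcl 1 0 0 0.

(* Distributes the product over the basis, using e1 (e1 e2) = - e2,
   (e1 e2) e1 = e2, e2 (e1 e2) = - s e1, (e1 e2) e2 = s e1, (e1 e2)^2 = s. *)
Definition cl_mul x y : cl s :=
  mkcl (co x 0 * co y 0 - co x 1 * co y 1 + s * co x 2 * co y 2 + s * co x 3 * co y 3)
       (co x 0 * co y 1 + co x 1 * co y 0 - s * co x 2 * co y 3 + s * co x 3 * co y 2)
       (co x 0 * co y 2 + co x 2 * co y 0 - co x 1 * co y 3 + co x 3 * co y 1)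
       (co x 0 * co y 3 + co x 3 * co y 0 + co x 1 * co y 2 - co x 2 * co y 1).

Lemma mkclE a b c d :
  (co (mkcl a b c d) 0 = a) * (co (mkcl a b c d) 1 = b) *
  (co (mkcl a b c d) 2 = c) * (co (mkcl a b c d) 3 = d).
Proof. by rewrite /co !mxE !inordK. Qed.

Lemma cl_eqP x y : co x 0 = co y 0 -> co x 1 = co y 1 ->
  co x 2 = co y 2 -> co x 3 = co y 3 -> x = y.
Proof.
move=> h0 h1 h2 h3; apply/rowP => i; rewrite -[i]inord_val.
by case: (val i) (ltn_ord i) => [|[|[|[|]]]].
Qed.

Lemma coD x y i : co (x + y) i = co x i + co y i.
Proof. by rewrite /co mxE. Qed.

Lemma coN x i : co (- x) i = - co x i.
Proof. by rewrite /co mxE. Qed.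

Lemma coZ t x i : co (t *: x) i = t * co x i.
Proof. by rewrite /co mxE. Qed.

Lemma co0 i : co 0 i = 0.
Proof. by rewrite /co mxE. Qed.

Let cl_mulA : associative cl_mul.
Proof. by move=> x y z; apply: cl_eqP; rewrite /cl_mul !mkclE; ring. Qed.

Let cl_mul1 : left_id cl_one cl_mul.
Proof. by move=> x; apply: cl_eqP; rewrite /cl_mul !mkclE; ring. Qed.

Let cl_1mul : right_id cl_one cl_mul.
Proof. by move=> x; apply: cl_eqP; rewrite /cl_mul !mkclE; ring. Qed.

Let cl_mulDl : left_distributive cl_mul +%R.
Proof.
by move=> x y z; apply: cl_eqP;
  rewrite /cl_mul !(coD, mkclE); ring.
Qed.

Let cl_mulDr : right_distributive cl_mul +%R.
Proof.
by move=> x y z; apply: cl_eqP;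
  rewrite /cl_mul !(coD, mkclE); ring.
Qed.

Let cl_one_neq0 : cl_one != 0.
Proof.
apply/eqP => /(congr1 (fun x => co x 0)) /eqP.
by rewrite mkclE co0 oner_eq0.
Qed.

HB.instance Definition _ := GRing.Zmodule_isNzRing.Build (cl s)
  cl_mulA cl_mul1 cl_1mul cl_mulDl cl_mulDr cl_one_neq0.

Let cl_scalerAl t x y : t *: (x * y) = t *: x * y.
Proof.
by apply: cl_eqP; rewrite !(coZ, mkclE); ring.
Qed.

Let cl_scalerAr t x y : t *: (x * y) = x * (t *: y).
Proof.
by apply: cl_eqP; rewrite !(coZ, mkclE); ring.
Qed.

HB.instance Definition _ := GRing.Lmodule_isLalgebra.Build K (cl s) cl_scalerAl.
HB.instance Definition _ := GRing.Lalgebra_isAlgebra.Build K (cl s) cl_scalerAr.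
HB.instance Definition _ := Algebra_isFalgebra.Build K (cl s).

Definition e1 : cl s := mkcl 0 1 0 0.
Definition e2 : cl s := mkcl 0 0 1 0.

Lemma e1_sqr : e1 ^+ 2 = -1.
Proof.
by rewrite expr2; apply: cl_eqP;
  rewrite !(coN, mkclE); ring.
Qed.

Lemma e2_sqr : e2 ^+ 2 = s%:A.
Proof.
by rewrite expr2; apply: cl_eqP;
  rewrite !(coZ, mkclE); ring.
Qed.

Lemma e1e2_anticomm : e1 * e2 = - (e2 * e1).
Proof.
by apply: cl_eqP; rewrite !(coN, mkclE); ring.
Qed.

Lemma cl_basisE a b c d :
  mkcl a b c d = a%:A + b *: e1 + c *: e2 + d *: (e1 * e2).
Proof.
by apply: cl_eqP;
  rewrite !(coD, coZ, mkclE); ring.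
Qed.

Lemma cl_basis : basis_of fullv [:: 1; e1; e2; e1 * e2].
Proof.
rewrite basisEdim dimvf /= leqnn andbT.
apply/subvP => x _.
have -> : x = mkcl (co x 0) (co x 1) (co x 2) (co x 3).
  by apply: cl_eqP; rewrite !mkclE.
by rewrite cl_basisE !rpredD// rpredZ// memv_span// !inE eqxx ?orbT.
Qed.

(* The plane is identified with the vectors of [cl s] through [vec]. *)
Definition vec (p : K * K) : cl s := p.1 *: e1 + p.2 *: e2.

Definition mobius_denom (M : 'M[cl s]_2) (w : cl s) : cl s :=
  M ord_max ord0 * w + M ord_max ord_max.

Definition mobius_defined (M : 'M[cl s]_2) (w : cl s) : bool :=
  mobius_denom M w \is a GRing.unit.

Definition mobius (M : 'M[cl s]_2) (w : cl s) : cl s :=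
  (M ord0 ord0 * w + M ord0 ord_max) * (mobius_denom M w)^-1.

(* The matrix (a, b; c, d) becomes (a, - b e1; c e1, d). *)
Definition SL2_cl (g : 'M[K]_2) : 'M[cl s]_2 :=
  \matrix_(i, j)
    if i == j then (g i j)%:A
    else if i == ord0 then - (g i j *: e1) else g i j *: e1.

Lemma mobius_SL2E (g : 'M[K]_2) (w : cl s) :
  mobius (SL2_cl g) w =
  (g ord0 ord0 *: w - g ord0 ord_max *: e1) *
  (g ord_max ord0 *: e1 * w + (g ord_max ord_max)%:A)^-1.
Proof. by rewrite /mobius /mobius_denom !mxE /= -scalerAl mul1r. Qed.

(* The image of a part [E] of the plane, again as a part of the plane; it
   loses no point of [g . E] by [mobius_vec]. *)
Definition mobius_image (g : 'M[K]_2) (E : set (K * K)) : set (K * K) :=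
  vec @^-1` (mobius (SL2_cl g) @` (vec @` E)).

Lemma vec_inj : injective vec.
Proof.
move=> [u v] [u' v'] h.
have := congr1 (fun x => co x 1) h; have := congr1 (fun x => co x 2) h.
rewrite /vec !(coD, coZ, mkclE) !mulr0 !mulr1 !add0r !addr0 /=.
by move=> -> ->.
Qed.

Lemma mobius_vec (g : 'M[K]_2) (p : K * K) :
  mobius_defined (SL2_cl g) (vec p) ->
  exists q, mobius (SL2_cl g) (vec p) = vec q.
Proof.
case: p => u v; rewrite /mobius_defined => Ud; rewrite /mobius.
set w := vec _ in Ud *; set D := mobius_denom _ _ in Ud *.
pose r := g ord_max ord_max - g ord_max ord0 * u; pose t := g ord_max ord0 * v.
have DE : D = mkcl r 0 0 t.
  apply: cl_eqP; rewrite /D /mobius_denom !mxE /= /w /vec /r /t;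
  rewrite !(coD, coN, coZ, mkclE) /=; ring.
pose N := r ^+ 2 - s * t ^+ 2.
have DD : mkcl r 0 0 (- t) * D = N%:A.
  by rewrite DE; apply: cl_eqP; rewrite !(coD, coN, coZ, mkclE) /N; ring.
have N0 : N != 0.
  apply/eqP => N0; move: DD; rewrite N0 scale0r => /(canRL (mulrK Ud)).
  rewrite mul0r => c0.
  have r0 : r = 0 by have := congr1 (co ^~ 0%N) c0; rewrite mkclE co0.
  have t0 : t = 0.
    have := congr1 (co ^~ 3%N) c0.
    by rewrite mkclE co0 => /eqP; rewrite oppr_eq0 => /eqP.
  move: Ud; rewrite DE r0 t0 (_ : mkcl _ _ _ _ = 0) ?unitr0//.
  by apply: cl_eqP; rewrite !mkclE co0.
have -> : D^-1 = N^-1 *: mkcl r 0 0 (- t).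
  apply: (mulIr Ud); rewrite mulVr// -scalerAl DD scalerA mulVf//.
  by rewrite scale1r.
pose a := g ord0 ord0 * u - g ord0 ord_max; pose b := g ord0 ord0 * v.
exists (N^-1 * (a * r + s * b * t), N^-1 * (b * r + a * t)).
apply: cl_eqP; rewrite !mxE /= /w /vec /a /b;
by rewrite !(coD, coN, coZ, mkclE) /=; ring.
Qed.

End Clifford.

Section InvariantMeasure.
Context (R : realType).
Local Open Scope ereal_scope.

Definition lebesgue2 := (@lebesgue_measure R \x @lebesgue_measure R).

(* The density takes the value 0, instead of +oo, on the null set v = 0. *)
Definition invariant_measure (A : set (measurableTypeR R * measurableTypeR R)) :
    \bar R :=
  \int[lebesgue2]_(p in A) ((p.2 ^+ 2)^-1)%:E.

Let invariant_measure0 : invariant_measure set0 = 0.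
Proof. by rewrite /invariant_measure integral_set0. Qed.

Let density_ge0 (p : measurableTypeR R * measurableTypeR R) :
  0 <= ((p.2 ^+ 2)^-1)%:E.
Proof. by rewrite lee_fin invr_ge0 sqr_ge0. Qed.

Let invariant_measure_ge0 A : 0 <= invariant_measure A.
Proof. by apply: integral_ge0 => p _; exact: density_ge0. Qed.

Let measurable_density : measurable_fun setT
  ((fun p => ((p.2 ^+ 2)^-1)%:E) :
    measurableTypeR R * measurableTypeR R -> \bar R).
Proof.
apply/measurable_EFinP.
rewrite (_ : (fun p => _) =
    (@powR R ^~ (-1)%R) \o (fun p => p.2 ^+ 2)%R); last first.
  by apply/funext => p /=; rewrite powR_inv1 ?sqr_ge0.
have m2 : measurable_fun setT
    (fun p : measurableTypeR R * measurableTypeR R => (p.2 ^+ 2)%R : R).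
  by apply: measurable_funX; exact: measurable_snd.
apply: (@measurableT_comp _ _ _ _ _ _ (@powR R ^~ (-1)%R)) m2.
exact: measurable_powR.
Qed.

Let invariant_measure_sigma_additive : semi_sigma_additive invariant_measure.
Proof. exact: semi_sigma_additive_nng_induced. Qed.

HB.instance Definition _ := isMeasure.Build _ _ _ invariant_measure
  invariant_measure0 invariant_measure_ge0 invariant_measure_sigma_additive.

End InvariantMeasure.

(* Main.v *)
Require Import Defs.
From mathcomp Require Import all_boot all_order all_algebra all_field.
From mathcomp Require Import ring.
From mathcomp Require Import all_classical all_reals all_analysis.
From mathcomp Require Import measurable_realfun.

Import Order.TTheory GRing.Theory Num.Theory.
Local Open Scope classical_set_scope.
Local Open Scope ring_scope.

(** Write [N(u, v) = (d - c u)^2 - s (c v)^2] for the norm of the denominator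
    [c e1 (u e1 + v e2) + d].  In real coordinates the transformation is
    [(u, v) |-> (n / N, v / N)] with [n = (a u - b) (d - c u) + s a c v^2]
    ([mobius_vecE]); the determinant 1 enters through the second coordinate.
    With the convention [x / 0 = 0] this is a total measurable map, and the map
    of the inverse matrix undoes it ([mobius_mapK]).  A point where the inverse
    is undefined is sent by it to a point with [v = 0], which [E] avoids, so
    [g . E] is exactly the preimage of [E] under the map of [g^-1]
    ([mobius_imageE]).  This gives measurability, and reduces the theorem to
    the invariance of [du dv / v^2] under preimages.

    No planar change of variables is needed, because the homogeneous
    coordinate [y = u / v] makes the problem one-dimensional.  Since
    [du = |v| dy] at fixed [v], the measure becomes [dy dv / |v|]
    ([invariant_measure_fibers]), and [dv / |v|] is the Haar measure of the
    multiplicative group of nonzero reals.  Up to translations in [u],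

    - if [c = 0], the map is [(u, v) |-> (u / d^2, v / d^2)]: it fixes [y] and
      rescales [v];
    - if [c <> 0], the map is the inversion [(u, v) |-> (- u, v) / N] with
      [N = c^2 (u^2 - s v^2)]; it takes [y] to [- y] and, at fixed [y], takes
      [v] to [k / v] with [k = 1 / (c^2 (y^2 - s))]
      ([mobius_map_homogeneous]).

    Haar measure is invariant under [v |-> k v], by the scaling of Lebesgue
    measure, and under [v |-> 1 / v] ([mult_integral_inv]).  The remaining
    reflection and translations in [u] preserve [du dv / v^2] trivially.  The
    parameter [s] enters only through the constant [k], so that one argument
    covers the elliptic, parabolic and hyperbolic cases. *)

Local Notation leb := lebesgue_measure.

(** * The Haar measure of the multiplicative group of the reals *)

Section OneVariable.
Context {R : realType}.
Local Notation TR := (measurableTypeR R).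
Implicit Types (F : TR -> \bar R) (k t : R).

Lemma measurable_inv : measurable_fun setT (GRing.inv : TR -> TR).
Proof.
(* With x^-1 = x (x^2)^-1, which holds at 0 too, only the inverse of a
   nonnegative number is needed, and this is a real power. *)
rewrite (_ : GRing.inv = fun x : TR => x * ((x ^+ 2) `^ (-1))).
  apply: measurable_funM => //.
  apply: (@measurableT_comp _ _ _ _ _ _ (@powR R ^~ (-1))).
    exact: measurable_powR.
  exact: exprn_measurable.
apply/funext => x; rewrite powR_inv1 ?sqr_ge0//.
by have [->|x0] := eqVneq x 0; [rewrite invr0 mul0r|field].
Qed.

Lemma measurable_affine k t :
  measurable_fun setT ((fun x => k * x + t) : TR -> TR).
Proof. by apply: measurable_funD => //; exact: mulrl_measurable. Qed.

Lemma lebesgue_measure_affine k t (k0 : 0 < `|k|) (A : set TR) :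
  measurable A ->
  leb A = (`|k|%:E * leb ((fun x => (k * x + t)%R) @^-1` A))%E.
Proof.
move=> mA.
pose m : {measure set TR -> \bar R} :=
  mscale (NngNum (ltW k0)) (pushforward leb (fun x : TR => k * x + t : TR)).
rewrite -[RHS]/(m (measurable_affine k t) A).
apply: lebesgue_measure_unique => // _ [[a b]] _ <-.
rewrite /m /= /mscale /= /pushforward.
have [kp|kn] := ltrP 0 k.
  rewrite (_ : _ @^-1` _ = `](a - t) / k, (b - t) / k]%classic); last first.
    apply/seteqP; split => x /=; rewrite !in_itv/= ltr_pdivrMr// ler_pdivlMr//;
    rewrite ltrBlDr lerBrDr mulrC//.
  rewrite !lebesgue_measure_itv/= !lte_fin ltr_pM2r ?invr_gt0// ltrD2r.
  case: ifPn => _; rewrite ?mule0// -!EFinB -EFinM gtr0_norm//; congr EFin.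
  by field; rewrite gt_eqF.
have {}kn : k < 0 by rewrite lt_neqAle kn andbT -normr_gt0.
rewrite (_ : _ @^-1` _ = `[(b - t) / k, (a - t) / k[%classic); last first.
  apply/seteqP; split => x /=; rewrite !in_itv/= ltr_ndivlMr// ler_ndivrMr//;
  by rewrite ltrBlDr lerBrDr mulrC// andbC.
rewrite !lebesgue_measure_itv/= !lte_fin ltr_nM2r ?invr_lt0// ltrD2r.
case: ifPn => _; rewrite ?mule0// -!EFinB -EFinM ltr0_norm//; congr EFin.
by field; rewrite lt_eqF.
Qed.

Lemma integral_affine k t F : k != 0 ->
  measurable_fun setT F -> (forall x, 0 <= F x)%E ->
  (\int[leb]_x F x = `|k|%:E * \int[leb]_x F (k * x + t)%R)%E.
Proof.
rewrite -normr_gt0 => k0 mF F0.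
have mkt := measurable_affine k t.
pose m : {measure set TR -> \bar R} :=
  mscale (NngNum (ltW k0)) (pushforward leb (fun x : TR => k * x + t : TR)).
rewrite (@eq_measure_integral _ _ _ _ (m mkt)).
  rewrite /m ge0_integral_mscale//; congr (_ * _)%E.
  by rewrite ge0_integral_pushforward.
by move=> A mA _; exact: lebesgue_measure_affine.
Qed.

Local Open Scope ereal_scope.

(** The integral of [F] against the Haar measure [dx / |x|] of the nonzero
    reals; as [0^-1 = 0], the value of [F] at 0 does not count. *)
Definition mult_integral F := \int[leb]_x (F x * (`|x|^-1)%:E).

Lemma measurable_abs_inv : measurable_fun setT (fun x : TR => (`|x|^-1)%:E).
Proof.
apply/measurable_EFinP.
exact: (measurableT_comp measurable_inv (@normr_measurable R setT)).
Qed.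

Lemma abs_inv_ge0 (x : R) : 0 <= (`|x|^-1)%:E.
Proof. by rewrite lee_fin invr_ge0. Qed.

Lemma mult_integral_scale k F : k != 0%R ->
  measurable_fun setT F -> (forall x, 0 <= F x) ->
  mult_integral (fun x => F (k * x)%R) = mult_integral F.
Proof.
move=> k0 mF F0; rewrite /mult_integral.
rewrite [RHS](@integral_affine k 0)//; last 2 first.
- by apply: emeasurable_funM => //; exact: measurable_abs_inv.
- by move=> x; rewrite mule_ge0// abs_inv_ge0.
rewrite -ge0_integralZl//; last 2 first.
- have mFw : measurable_fun setT (fun x : TR => F x * (`|x|^-1)%:E).
    by apply: emeasurable_funM => //; exact: measurable_abs_inv.
  exact: (measurableT_comp mFw (measurable_affine k 0)).
- by move=> x _; rewrite mule_ge0// abs_inv_ge0.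
apply: eq_integral => x _; rewrite addr0 muleCA -EFinM normrM invfM mulrA.
by rewrite mulfV ?normr_eq0// mul1r.
Qed.

(** The usual argument that the Haar measure [m] of a unimodular group is
    invariant under inversion.  With [S] of integral 1, rescaling one variable
    at a time and exchanging the order of integration give
    [m(F(1/y)) = m(S(x) F(1/y)) = m(S(x) F(x/y)) = m(S(x y) F(x))
     = m(S(y) F(x)) = m(F)],
    where the intermediate integrals are taken over [x] and [y]. *)
Lemma mult_integral_inv F :
  measurable_fun setT F -> (forall x, 0 <= F x) ->
  mult_integral (fun x => F (x^-1)%R) = mult_integral F.
Proof.
move=> mF F0.
pose w (x : TR) := (`|x|^-1)%:E.
(* The factor |x| cancels the Haar density, so that S has integral 1. *)
pose S (x : TR) := (`|x| * \1_`]0%R, 1%R] x)%:E.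
have w0 x : 0 <= w x by exact: abs_inv_ge0.
have mw : measurable_fun setT w by exact: measurable_abs_inv.
have S0 x : 0 <= S x by rewrite lee_fin mulr_ge0// indicE.
have mS : measurable_fun setT S.
  apply/measurable_EFinP; apply: measurable_funM.
    exact: normr_measurable.
  by apply: measurable_indic; exact: measurable_itv.
have S1 : mult_integral S = 1.
  rewrite /mult_integral -[RHS](_ : leb `]0%R, 1%R]%classic = _); last first.
    by rewrite lebesgue_measure_itv/= lte_fin ltr01 oppr0 adde0.
  rewrite -[in RHS](setIT `]0%R, 1%R]%classic) -integral_indic//.
  apply: eq_integral => x _; rewrite /S -EFinM; congr EFin.
  have [->|x0] := eqVneq x 0%R; last by rewrite mulrAC mulfV ?normr_eq0// mul1r.
  by rewrite normr0 invr0 mulr0 indicE memNset//= in_itv/= ltxx.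
have mcomp (G : TR -> \bar R) (f : TR * TR -> TR) : measurable_fun setT G ->
    measurable_fun setT f -> measurable_fun setT (fun p => G (f p)).
  by move=> mG mf; exact: measurableT_comp.
have mFi : measurable_fun setT (fun x : TR => F x^-1%R).
  by apply: (measurableT_comp mF); exact: measurable_inv.
have m1 := @measurable_fst _ _ TR TR; have m2 := @measurable_snd _ _ TR TR.
have mi2 : measurable_fun setT (fun p : TR * TR => p.2^-1%R).
  exact: (measurableT_comp measurable_inv).
transitivity (\int[leb]_x \int[leb]_y (S x * w x * (F (x * y^-1)%R * w y))).
  transitivity (\int[leb]_x (S x * w x * mult_integral (fun y => F (y^-1)%R))).
    rewrite ge0_integralZr//.
    - by rewrite -/(mult_integral S) S1 mul1e.
    - exact: emeasurable_funM.
    - by move=> x _; rewrite mule_ge0.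
    - by apply: integral_ge0 => x _; rewrite mule_ge0.
  apply: eq_integral => x _; have [->|x0] := eqVneq x 0%R.
    rewrite /w normr0 invr0 mule0 mul0e.
    by under [RHS]eq_integral do rewrite mul0e; rewrite integral0.
  have mFx : measurable_fun setT (fun y : TR => F (x * y^-1)%R).
    apply: (measurableT_comp mF); apply: measurable_funM => //.
    exact: measurable_inv.
  rewrite ge0_integralZl//; last 3 first.
  - exact: emeasurable_funM.
  - by move=> y _; rewrite mule_ge0.
  - by rewrite mule_ge0.
  congr (_ * _); rewrite -(@mult_integral_scale x^-1)//; last first.
    by rewrite invr_eq0.
  by apply: eq_integral => y _; rewrite invfM invrK.
rewrite (fubini_tonelli (fun p : TR * TR =>
    S p.1 * w p.1 * (F (p.1 * p.2^-1)%R * w p.2))); last 2 first.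
- apply: emeasurable_funM; apply: emeasurable_funM; apply: mcomp => //.
  exact: measurable_funM.
- by move=> p; rewrite !mule_ge0.
transitivity (\int[leb]_y \int[leb]_x (F x * w x * (S (x * y)%R * w y))).
  apply: eq_integral => y _ /=; have [->|y0] := eqVneq y 0%R.
    rewrite /w normr0 invr0.
    by under eq_integral do rewrite !mule0;
       under [RHS]eq_integral do rewrite !mule0.
  pose G x := S x * F (x * y^-1)%R.
  have mG : measurable_fun setT G.
    apply: emeasurable_funM => //; apply: (measurableT_comp mF).
    exact: mulrr_measurable.
  have G0 x : 0 <= G x by rewrite mule_ge0.
  transitivity (\int[leb]_x (G x * w x) * w y).
    rewrite -ge0_integralZr//.
    - by apply: eq_integral => x _; rewrite /G !muleA (muleAC (S x)).
    - exact: emeasurable_funM.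
    - by move=> x _; rewrite mule_ge0.
  have mGy : measurable_fun setT (fun x => G (y * x)%R).
    by apply: (measurableT_comp mG); exact: mulrl_measurable.
  rewrite -/(mult_integral G) -(@mult_integral_scale y)// -ge0_integralZr//.
  - apply: eq_integral => x _; rewrite /G mulrAC mulfV// mul1r.
    by rewrite (mulrC y) (muleC (S _)) !muleA (muleAC (F x)).
  - exact: emeasurable_funM.
  - by move=> x _; rewrite mule_ge0.
rewrite -(fubini_tonelli (fun p : TR * TR =>
    F p.1 * w p.1 * (S (p.1 * p.2)%R * w p.2))); last 2 first.
- apply: emeasurable_funM; apply: emeasurable_funM; apply: mcomp => //.
  exact: measurable_funM.
- by move=> p; rewrite !mule_ge0.
apply: eq_integral => x _ /=; have [->|x0] := eqVneq x 0%R.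
  rewrite /w normr0 invr0 mule0.
  by under eq_integral do rewrite mul0e; rewrite integral0.
have mSx : measurable_fun setT (fun y : TR => S (x * y)%R).
  by apply: (measurableT_comp mS); exact: mulrl_measurable.
rewrite ge0_integralZl//; last 3 first.
- exact: emeasurable_funM.
- by move=> y _; rewrite mule_ge0.
- by rewrite mule_ge0.
rewrite -/(mult_integral (fun y => S (x * y)%R)).
by rewrite mult_integral_scale// S1 mule1.
Qed.

Lemma mult_integral_scale_inv k F : k != 0%R ->
  measurable_fun setT F -> (forall x, 0 <= F x) ->
  mult_integral (fun x => F (k / x)%R) = mult_integral F.
Proof.
move=> k0 mF F0.
have mFk : measurable_fun setT (fun x : TR => F (k * x)%R).
  by apply: (measurableT_comp mF); exact: mulrl_measurable.
by rewrite (mult_integral_inv (fun x => F (k * x)%R))// mult_integral_scale.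
Qed.

End OneVariable.

(** * The invariant measure in homogeneous coordinates *)

Section PlaneMeasure.
Context {R : realType}.
Local Notation TR := (measurableTypeR R).
Implicit Types (A : set (TR * TR)) (e t : R).
Local Open Scope ereal_scope.

Lemma measurable_density :
  measurable_fun setT (fun p : TR * TR => ((p.2 ^+ 2)^-1)%:E).
Proof.
apply/measurable_EFinP; apply: (measurableT_comp measurable_inv).
by apply: measurable_funX; exact: measurable_snd.
Qed.

Lemma measurable_indic_comp {d'} {T : measurableType d'} A (f : T -> TR * TR) :
  measurable A -> measurable_fun setT f ->
  measurable_fun setT (fun p => (\1_A (f p) : R)%:E).
Proof.
move=> mA mf; apply/measurable_EFinP.
by apply: (measurableT_comp _ mf); exact: measurable_indic.
Qed.

Lemma measurable_preimage A (f : TR * TR -> TR * TR) :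
  measurable A -> measurable_fun setT f -> measurable (f @^-1` A).
Proof. by move=> mA mf; rewrite -[X in measurable X]setTI; exact: mf. Qed.

Lemma measurable_affine1 e t :
  measurable_fun setT (fun p : TR * TR => (e * p.1 + t, p.2)%R : TR * TR).
Proof.
apply: measurable_fun_pair; last exact: measurable_snd.
by apply: (measurableT_comp (measurable_affine e t)); exact: measurable_fst.
Qed.

Lemma indicE_ge0 A p : 0 <= (\1_A p : R)%:E.
Proof. by rewrite lee_fin indicE. Qed.

Lemma density_ge0 (p : TR * TR) : 0 <= ((p.2 ^+ 2)^-1)%:E.
Proof. by rewrite lee_fin invr_ge0 sqr_ge0. Qed.

Lemma invariant_measure_iterated A : measurable A ->
  invariant_measure A =
  \int[leb]_v \int[leb]_u ((\1_A (u, v) : R)%:E * ((v ^+ 2)^-1)%:E).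
Proof.
move=> mA; rewrite /invariant_measure integral_mkcond epatch_indic.
pose f (p : TR * TR) := (\1_A p : R)%:E * ((p.2 ^+ 2)^-1)%:E.
transitivity (\int[@lebesgue2 R]_p f p).
  by apply: eq_integral => p _ /=; rewrite muleC.
apply: (fubini_tonelli2 f).
- apply: emeasurable_funM measurable_density.
  exact/measurable_EFinP/measurable_indic.
- by move=> p; rewrite mule_ge0 ?indicE_ge0// density_ge0.
Qed.

Lemma invariant_measure_isometry e t A : `|e|%R = 1%R -> measurable A ->
  invariant_measure ((fun p : TR * TR => (e * p.1 + t, p.2)%R) @^-1` A) =
  invariant_measure A.
Proof.
move=> e1 mA.
have mB := measurable_preimage _ _ mA (measurable_affine1 e t).
rewrite (invariant_measure_iterated _ mB) (invariant_measure_iterated _ mA).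
apply: eq_integral => v _.
pose F (u : TR) := (\1_A (u, v) : R)%:E * ((v ^+ 2)^-1)%:E.
have mF : measurable_fun setT F.
  apply: emeasurable_funM => //.
  by apply: measurable_indic_comp => //; exact: pair2_measurable.
have F0 u : 0 <= F u.
  by rewrite mule_ge0 ?indicE_ge0// lee_fin invr_ge0 sqr_ge0.
have e0 : e != 0%R by rewrite -normr_eq0 e1 oner_eq0.
by rewrite -/(\int[leb]_u F u) (integral_affine e t F e0 mF F0) e1 mul1e.
Qed.

(** For [v <> 0] substitute [u = y v]: the Jacobian [|v|] turns [1 / v^2] into
    [1 / |v|].  The line [v = 0] has density 0 on both sides. *)
Lemma invariant_measure_fibers A : measurable A ->
  invariant_measure A =
  \int[leb]_y mult_integral (fun v => (\1_A (y * v, v)%R : R)%:E).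
Proof.
move=> mA; rewrite (invariant_measure_iterated _ mA).
have mf : measurable_fun setT (fun p : TR * TR => (p.1 * p.2, p.2)%R : TR * TR).
  apply: measurable_fun_pair; last exact: measurable_snd.
  by apply: measurable_funM; [exact: measurable_fst|exact: measurable_snd].
rewrite (fubini_tonelli (m1 := leb) (m2 := leb) (fun p : TR * TR =>
    (\1_A (p.1 * p.2, p.2)%R : R)%:E * (`|p.2|^-1)%:E)); last 2 first.
- apply: emeasurable_funM; first exact: measurable_indic_comp.
  exact: (measurableT_comp measurable_abs_inv).
- by move=> p; rewrite mule_ge0 ?indicE_ge0// abs_inv_ge0.
apply: eq_integral => v _ /=; have [->|v0] := eqVneq v 0%R.
  by rewrite normr0 expr0n/= invr0; under eq_integral do rewrite mule0;
     under [RHS]eq_integral do rewrite mule0.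
have mAv : measurable_fun setT (fun u : TR =>
    (\1_A (u, v) : R)%:E * ((v ^+ 2)^-1)%:E).
  apply: emeasurable_funM => //.
  by apply: measurable_indic_comp => //; exact: pair2_measurable.
have Av0 (u : TR) : 0 <= (\1_A (u, v) : R)%:E * ((v ^+ 2)^-1)%:E.
  by rewrite mule_ge0 ?indicE_ge0// lee_fin invr_ge0 sqr_ge0.
rewrite (@integral_affine _ v 0%R)// -ge0_integralZl//; last first.
  exact: (measurableT_comp mAv (measurable_affine _ _)).
apply: eq_integral => y _; rewrite addr0 (mulrC v) -!EFinM; congr EFin.
rewrite [LHS]mulrCA; congr (_ * _)%R; rewrite -(real_normK (num_real v)).
by rewrite expr2 invfM mulrA mulfV ?normr_eq0// mul1r.
Qed.

End PlaneMeasure.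

(** * The transformation in real coordinates *)

Section MobiusCoordinates.
Context {K : fieldType} (s : K).
Implicit Types (a b c d : K) (p : K * K) (g : 'M[K]_2).

(** The norm of the denominator [r + t e1 e2], with [r = d - c u] and
    [t = c v]: its product with the conjugate [r - t e1 e2]. *)
Definition mobius_norm c d p : K := (d - c * p.1) ^+ 2 - s * (c * p.2) ^+ 2.

Definition mobius_map a b c d p : K * K :=
  (((a * p.1 - b) * (d - c * p.1) + s * a * c * p.2 ^+ 2) / mobius_norm c d p,
   p.2 / mobius_norm c d p).

(** At an image point, the factors [a + c u'] and [d u' + b] of the formula of
    the inverse map are combinations of [n / N] and 1, which the determinant 1
    simplifies, here and in [mobius_map_numer]. *)
Lemma mobius_map_denom a b c d p :
  a * d - b * c = 1 -> mobius_norm c d p != 0 ->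
  a + c * (mobius_map a b c d p).1 = (d - c * p.1) / mobius_norm c d p.
Proof.
move=> det1 N0; apply: (mulIf N0); rewrite mulfVK//.
rewrite mulrDl /= -[c * _ * _]mulrA mulfVK//.
by rewrite -[RHS]mul1r -det1 /mobius_norm; ring.
Qed.

Lemma mobius_map_numer a b c d p :
  a * d - b * c = 1 -> mobius_norm c d p != 0 ->
  d * (mobius_map a b c d p).1 + b =
  (p.1 * (d - c * p.1) + s * c * p.2 ^+ 2) / mobius_norm c d p.
Proof.
move=> det1 N0; apply: (mulIf N0); rewrite mulfVK//.
rewrite mulrDl /= -[d * _ * _]mulrA mulfVK//.
by rewrite -[RHS]mul1r -det1 /mobius_norm; ring.
Qed.

(** The cocycle relation: the denominators of a map and of its inverse are
    inverse to each other, hence so are their norms. *)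
Lemma mobius_norm_map a b c d p : a * d - b * c = 1 -> mobius_norm c d p != 0 ->
  mobius_norm (- c) a (mobius_map a b c d p) = (mobius_norm c d p)^-1.
Proof.
move=> det1 N0; rewrite /mobius_norm mulNr opprK mobius_map_denom//=.
rewrite mulNr sqrrN [c * (_ / _)]mulrA !expr_div_n [s * (_ / _)]mulrA -mulrBl.
by rewrite -/(mobius_norm c d p) expr2 invfM mulrA mulfV// mul1r.
Qed.

Lemma mobius_mapK a b c d p : a * d - b * c = 1 -> mobius_norm c d p != 0 ->
  mobius_map d (- b) (- c) a (mobius_map a b c d p) = p.
Proof.
move=> det1 N0; rewrite {1}/mobius_map mobius_norm_map// invrK opprK.
rewrite mulNr opprK mobius_map_denom// mobius_map_numer//=.
case: p N0 => u v; rewrite /mobius_norm /= => N0.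
by congr pair; [field|rewrite mulfVK].
Qed.

(** The denominator is a unit only if its norm is nonzero, because it is
    annihilated by its conjugate otherwise; its inverse is then its conjugate
    divided by the norm. *)
Lemma mobius_vecE g p (a := g ord0 ord0) (b := g ord0 ord_max)
    (c := g ord_max ord0) (d := g ord_max ord_max) :
  a * d - b * c = 1 -> mobius_defined (SL2_cl s g) (vec s p) ->
  mobius_norm c d p != 0 /\
  mobius (SL2_cl s g) (vec s p) = vec s (mobius_map a b c d p).
Proof.
case: p => u v; rewrite /mobius_defined /mobius => det1 Ud.
set D := mobius_denom _ _ in Ud *; set N := mobius_norm _ _ _.
have DE : D = mkcl s (d - c * u) 0 0 (c * v).
  by apply: cl_eqP; rewrite /D /mobius_denom !mxE /= /vec;
     rewrite !(coD, coN, coZ, mkclE) /= -/c -/d; ring.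
have DD : mkcl s (d - c * u) 0 0 (- (c * v)) * D = N%:A.
  by rewrite DE; apply: cl_eqP;
     rewrite !(coD, coN, coZ, mkclE) /N /mobius_norm /=; ring.
have N0 : N != 0.
  apply/eqP => N0; move: DD; rewrite N0 scale0r => /(canRL (mulrK Ud)).
  rewrite mul0r => c0; move: Ud; rewrite DE.
  have /= := congr1 (fun x : cl s => co x 0) c0; rewrite mkclE co0 => ->.
  have /= := congr1 (fun x : cl s => co x 3) c0; rewrite mkclE co0 => /eqP.
  rewrite oppr_eq0 => /eqP ->; rewrite (_ : mkcl _ _ _ _ _ = 0) ?unitr0//.
  by apply: cl_eqP; rewrite !mkclE co0.
split=> //.
have -> : D^-1 = N^-1 *: mkcl s (d - c * u) 0 0 (- (c * v)).
  by apply: (mulIr Ud); rewrite mulVr// -scalerAl DD scalerA mulVf// scale1r.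
(* The coefficient of e2 in the product is (a d - b c) v / N. *)
have -> : mobius_map a b c d (u, v) =
    (((a * u - b) * (d - c * u) + s * a * c * v ^+ 2) / N,
     (a * d - b * c) * v / N) by rewrite det1 mul1r.
apply: cl_eqP; rewrite !mxE /= /vec;
by rewrite !(coD, coN, coZ, mkclE) /= -/a -/b -/c -/d; ring.
Qed.

Lemma det_mx2 g :
  \det g = g ord0 ord0 * g ord_max ord_max - g ord0 ord_max * g ord_max ord0.
Proof.
rewrite (expand_det_row _ ord0) !big_ord_recl big_ord0 /cofactor !det_mx11 !mxE.
rewrite /= addr0 expr0 mul1r expr1 mulN1r mulrN.
by congr (_ * g _ _ - g _ _ * g _ _); apply: val_inj.
Qed.

(** At a point [q] where the inverse map is undefined, its conventional value
    has second coordinate [q.2 / 0 = 0] and is not in [E]; so the preimage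
    contains no point besides those of [g . E]. *)
Lemma mobius_imageE g (E : set (K * K)) : \det g = 1 ->
  E `<=` [set p | p.2 != 0] ->
  (forall p, E p -> mobius_defined (SL2_cl s g) (vec s p)) ->
  mobius_image s g E =
  mobius_map (g ord_max ord_max) (- g ord0 ord_max)
    (- g ord_max ord0) (g ord0 ord0) @^-1` E.
Proof.
set a := g ord0 ord0; set b := g ord0 ord_max.
set c := g ord_max ord0; set d := g ord_max ord_max.
move=> det1 E_v E_def.
have {}det1 : a * d - b * c = 1.
  by rewrite -det1 det_mx2.
apply/seteqP; split => q /=.
  move=> [_ [p Ep <-]]; have [N0 ->] := mobius_vecE _ _ det1 (E_def _ Ep).
  by move/vec_inj => <-; rewrite mobius_mapK.
set p := mobius_map _ _ _ _ q => Ep.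
have [N0 pE] := mobius_vecE _ _ det1 (E_def _ Ep).
exists (vec s p); first by exists p.
rewrite pE; congr (vec s _).
have Nq : mobius_norm (- c) a q != 0.
  by apply: contraTN (E_v _ Ep) => /eqP /= ->; rewrite invr0 mulr0 eqxx.
rewrite -/a -/b -/c -/d.
rewrite -[in LHS](opprK b) -[in LHS](opprK c) mobius_mapK//.
by rewrite mulrNN (mulrC d).
Qed.

End MobiusCoordinates.

(** * Invariance *)

Section Invariance.
Context {R : realType} (s : R).
Local Notation TR := (measurableTypeR R).
Implicit Types (E : set (TR * TR)) (a b c d : R).

Lemma measurable_mobius_map a b c d :
  measurable_fun setT (mobius_map s a b c d : TR * TR -> TR * TR).
Proof.
have mX := @measurable_fst _ _ TR TR; have mY := @measurable_snd _ _ TR TR.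
have mr : measurable_fun setT (fun p : TR * TR => d - c * p.1 : TR).
  by apply: measurable_funB => //; exact: measurable_funM.
have mN : measurable_fun setT
    (fun p : TR * TR => (mobius_norm s c d p)^-1 : TR).
  apply: (measurableT_comp measurable_inv); apply: measurable_funB.
    exact: measurable_funX.
  apply: measurable_funM => //; apply: measurable_funX.
  exact: measurable_funM.
apply: measurable_fun_pair; apply: measurable_funM => //.
apply: measurable_funD.
  apply: measurable_funM => //; apply: measurable_funB => //.
  exact: measurable_funM.
by apply: measurable_funM => //; exact: measurable_funX.
Qed.

Lemma measurable_fiber (A : set (TR * TR)) (y : TR) : measurable A ->
  measurable_fun setT (fun v : TR => (\1_A (y * v, v) : R)%:E).
Proof.
move=> mA; apply: measurable_indic_comp => //.
by apply: measurable_fun_pair => //; exact: mulrl_measurable.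
Qed.

Lemma eq_indic {T T' : Type} (A : set T) (B : set T') x y :
  (A x <-> B y) -> \1_A x = \1_B y :> R.
Proof.
move=> AB; rewrite !indicE; suff -> : (x \in A) = (y \in B) by [].
by apply/idP/idP; rewrite !inE AB.
Qed.

(** After the translation by [d / c] the denominator is [- c u + c v e1 e2],
    of norm [c^2 (u^2 - s v^2)].  Up to the translation by [- a / c], the map
    is the inversion, which sends the point of homogeneous coordinates [(y, v)]
    to [(- y, w)]. *)
Lemma mobius_map_homogeneous a b c d (y v : R) : a * d - b * c = 1 ->
  c != 0 -> y ^+ 2 != s -> v != 0 ->
  let w := (c ^+ 2 * (y ^+ 2 - s))^-1 / v in
  mobius_map s a b c d (y * v + d / c, v) = (- (y * w) - a / c, w).
Proof.
move=> det1 c0 ys v0 /=; rewrite -subr_eq0 in ys.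
have NE : mobius_norm s c d (y * v + d / c, v) = c ^+ 2 * (y ^+ 2 - s) * v ^+ 2.
  by rewrite /mobius_norm /=; field.
rewrite /mobius_map NE /=.
have -> : a * (y * v + d / c) - b = a * y * v + 1 / c.
  by rewrite -[in RHS]det1; field.
by congr pair; field; rewrite c0 ys v0.
Qed.

Lemma invariant_measure_mobius_map_affine a b d E : a * d = 1 ->
  measurable E ->
  invariant_measure (mobius_map s a b 0 d @^-1` E) = invariant_measure E.
Proof.
move=> ad1 mE; have d0 : d != 0.
  by apply: contra_eq_neq ad1 => ->; rewrite mulr0 eq_sym oner_eq0.
have mA := measurable_preimage _ _ mE (measurable_mobius_map a b 0 d).
have mB := measurable_preimage _ _ mE (measurable_affine1 1 (- (b / d))).
rewrite -[RHS](invariant_measure_isometry _ (- (b / d)) _ (normr1 R) mE).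
set B := (X in _ = invariant_measure X); have {}mB : measurable B by [].
rewrite (invariant_measure_fibers _ mA) (invariant_measure_fibers _ mB).
apply: eq_integral => y _; have k0 : d ^- 2 != 0 by rewrite invr_eq0 expf_neq0.
rewrite -(mult_integral_scale _ _ k0 (measurable_fiber B y mB)); last first.
  by move=> v; exact: indicE_ge0.
congr mult_integral; apply/funext => v; congr EFin; apply: eq_indic.
suff e : (mobius_map s a b 0 d @^-1` E) (y * v, v) =
    B (y * (d ^- 2 * v), d ^- 2 * v) by rewrite e.
rewrite /B /= mul1r; congr E; rewrite /mobius_map /mobius_norm /=.
have -> : a = d^-1 by apply: (mulIf d0); rewrite ad1 mulVf.
by congr pair; field.
Qed.

(** The lines [y^2 = s] are the isotropic directions, where the inversion is
    undefined.  They are not part of either preimage: the hypotheses say that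
    [E] avoids [v = 0], where the map sends them by convention, and avoids the
    points where the inverse map is undefined. *)
Lemma invariant_measure_mobius_map_inversion a b c d E : a * d - b * c = 1 ->
  c != 0 -> measurable E -> E `<=` [set p | p.2 != 0] ->
  (forall p, E p -> mobius_norm s (- c) a p != 0) ->
  invariant_measure (mobius_map s a b c d @^-1` E) = invariant_measure E.
Proof.
move=> det1 c0 mE E_v E_N.
have mM := measurable_preimage _ _ mE (measurable_mobius_map a b c d).
have mA := measurable_preimage _ _ mM (measurable_affine1 1 (d / c)).
have mB := measurable_preimage _ _ mE (measurable_affine1 (-1) (- (a / c))).
rewrite -(invariant_measure_isometry _ (d / c) _ (normr1 R) mM).
(* The reflection in u compensates for the change of sign of y. *)
rewrite -[RHS](invariant_measure_isometry _ (- (a / c)) _ (normrN1 R) mE).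
set A := (X in invariant_measure X = _); have {}mA : measurable A by [].
set B := (X in _ = invariant_measure X); have {}mB : measurable B by [].
rewrite (invariant_measure_fibers _ mA) (invariant_measure_fibers _ mB).
apply: eq_integral => y _.
have AE v : A (y * v, v) = E (mobius_map s a b c d (y * v + d / c, v)).
  by rewrite /A /= mul1r.
have BE v : B (y * v, v) = E (- (y * v) - a / c, v).
  by rewrite /B /= mulN1r.
have [ys|ys] := eqVneq (y ^+ 2) s.
  congr mult_integral; apply/funext => v; rewrite !indicE !memNset//.
    rewrite BE => /E_N /eqP; apply; rewrite /mobius_norm /= -ys.
    by field.
  rewrite AE => /E_v /= /eqP; apply.
  rewrite /mobius_norm /= -ys (_ : _ - _ = 0) ?invr0 ?mulr0//.
  by field.
pose k := (c ^+ 2 * (y ^+ 2 - s))^-1.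
have k0 : k != 0 by rewrite invr_eq0 mulf_neq0 ?expf_neq0// subr_eq0.
rewrite -(mult_integral_scale_inv _ _ k0 (measurable_fiber B y mB)); last first.
  by move=> v; exact: indicE_ge0.
congr mult_integral; apply/funext => v; congr EFin; apply: eq_indic.
rewrite AE BE; have [->|v0] := eqVneq v 0; last first.
  by rewrite mobius_map_homogeneous.
by split=> /E_v /=; rewrite ?invr0 ?mulr0 ?mul0r eqxx.
Qed.

End Invariance.

Theorem lemma2p13 (R : realType) (sigma : R)
    (sigmaP : sigma \in [:: -1; 0; 1])
    (g : 'M[R]_2) (g_SL2 : \det g = 1)
    (E : set (measurableTypeR R * measurableTypeR R))
    (mE : measurable E) (E_v : E `<=` [set p | p.2 != 0])
    (E_def : forall p, E p -> mobius_defined (SL2_cl sigma g) (vec sigma p)) :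
  measurable (mobius_image sigma g E :
    set (measurableTypeR R * measurableTypeR R)) /\
  invariant_measure (mobius_image sigma g E) = invariant_measure E.
Proof.
rewrite mobius_imageE//; split.
  by apply: measurable_preimage => //; exact: measurable_mobius_map.
have det1 := g_SL2; rewrite det_mx2 in det1.
have [c0|c0] := eqVneq (g ord_max ord0) 0.
  rewrite c0 oppr0; apply: invariant_measure_mobius_map_affine => //.
  by rewrite mulrC -det1 c0 mulr0 subr0.
apply: invariant_measure_mobius_map_inversion => //.
- by rewrite mulrNN mulrC.
- by rewrite oppr_eq0.
- by move=> p /E_def /mobius_vecE; rewrite opprK => -[].
Qed.
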